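(* Let $p\in(0,1)$. Consider the number line graph on $\mathbb{Z}$, which has a directed edge $(i,j)$ for all integers $i<j$, with independent edge weights $w(i,j)\sim\mathrm{Bernoulli}(p)$. For $n\ge1$, let $X_n$ be the maximum weight of a directed path from $1$ to $n$, and let $X_n^+=\max(X_n,0)$. Set \[ \beta_{tr}(p)=\Big(\sum_{n\ge1}(1-p)^{\binom{n}{2}}\Big)^{-1}. \] Then $\frac{X_n}{n-1}\to\beta_{tr}(p)$ almost surely, and $\frac{X_n^+}{n-1}\to\beta_{tr}(p)$ in $L^1$, as $n\to\infty$. In particular, $\lim_{n\to\infty}\frac{\mathbb{E}[X_n]}{n-1}=\beta_{tr}(p)$.
   Context: Every edge weight is independently $1$ with probability $p$ and $0$ otherwise. The weight of a directed path is the sum of the weights of its edges. Any directed path from $1$ to $n$ uses only vertices in $\{1,\ldots,n\}$. All $X_n$ are defined on the same probability space, namely that of the weights on the whole number line. $\binom{1}{2}=0$. *)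

(* Defs.v *)
From HB Require Import structures.
From mathcomp Require Import all_boot all_order all_algebra.
From mathcomp Require Import all_classical all_reals all_analysis.
Set Implicit Arguments. Unset Strict Implicit. Unset Printing Implicit Defensive.
Import Order.TTheory GRing.Theory Num.Theory.
Local Open Scope classical_set_scope.
Local Open Scope ring_scope.

(* Edge weights: w i j t = true means weight 1, false means weight 0.
   A family of independent Bernoulli(p) edge weights on the edges (i,j), i<j,
   of the number line graph on Z: each w i j is an event (measurable), and for
   every finite list of distinct edges and every prescribed 0/1 pattern, the
   probability of the pattern is the product of the Bernoulli(p) masses. *)
Definition bernoulli_edge_weights {d} {T : measurableType d} {R : realType}
  (P : probability T R) (p : R) (w : int -> int -> T -> bool) : Prop :=
  (forall i j : int, measurable [set t | w i j t]) /\
  (forall (s : seq (int * int)) (b : int * int -> bool),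
     uniq s -> all (fun e => e.1 < e.2) s ->
     P (\bigcap_(e in [set` s]) [set t | w e.1 e.2 t = b e]) =
     (\prod_(e <- s) (if b e then p else 1 - p))%:E).

(* Directed paths from 1 to n in the number line graph: strictly increasing
   vertex sequences starting at 1 and ending at n (necessarily inside {1..n});
   they are exactly the subsequences of [1;..;n] with head 1 and last n. *)
Definition paths_1n (n : nat) : seq (seq nat) :=
  [seq s <- [seq mask (tval b) (iota 1 n) | b : n.-tuple bool]
     | [&& s != [::], head 0%N s == 1%N & last 0%N s == n]].

Definition path_weight {T : Type} (w : int -> int -> T -> bool)
  (s : seq nat) (t : T) : nat :=
  \sum_(e <- zip s (behead s)) (w (Posz e.1) (Posz e.2) t : nat).

Definition Xmax {T : Type} (w : int -> int -> T -> bool) (n : nat) (t : T) : nat :=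
  \max_(s <- paths_1n n) path_weight w s t.

Definition Xplus {R : realType} {T : Type} (w : int -> int -> T -> bool)
  (n : nat) (t : T) : R :=
  Num.max ((Xmax w n t)%:R) 0.

Definition beta_tr {R : realType} (p : R) : R :=
  (\big[+%R/0%R]_(1 <= n <oo) ((1 - p) ^+ 'C(n, 2)))^-1.

(* Main.v *)
Require Import Defs.
From HB Require Import structures.
From mathcomp Require Import all_boot all_order all_algebra.
From mathcomp Require Import all_classical all_reals all_analysis.
From mathcomp Require Import measurable_realfun zify ring lra.
Import Order.TTheory GRing.Theory Num.Theory numFieldNormedType.Exports.
Local Open Scope classical_set_scope.
Local Open Scope ring_scope.

(* X_n is nondecreasing in n, and X_{n+1} = X_n + 1 exactly when some vertex j
   of the top level {j <= n | X_j = X_n} has w(j, n+1) = 1; otherwise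
   X_{n+1} = X_n. The top level is an interval ending at n; if it has k
   elements, then given the edges inside {1..n} it is extended to k + 1
   elements with probability q^k, q = 1 - p, and otherwise X increases and the
   level is reset to one element. So (X_n, k) is a Markov chain, with mean
   level length sum_n q^C(n,2) = 1/beta. With
   S_k = sum_i q^(k i + C(i,2)), which satisfies S_k = 1 + q^k S_(k+1) and
   S_1 = 1/beta, the process X_n - beta (n - 1) + 1 - beta S_k is a martingale
   with bounded increments, so its fourth moment is O(n^2). Hence the fourth
   moments of X_n/(n-1) - beta are summable, which gives almost sure
   convergence; the rest is dominated convergence. *)

(** * Longest paths as a function of the edge weights *)

Section longest_path.
Local Open Scope nat_scope.
Context {T : Type}.
Implicit Types (w : int -> int -> T -> bool) (t : T) (s : seq nat).

Lemma path_ltn_leq_last x s y : path ltn x s -> y \in x :: s -> y <= last x s.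
Proof.
elim: s x y => [x y _|z s IH x y /= /andP[xz zs]].
  by rewrite inE => /eqP->.
rewrite inE => /orP[/eqP->|/IH]; last exact.
by apply: leq_trans (ltnW xz) _; apply: IH => //; rewrite inE eqxx.
Qed.

(** Replaces masks by strict sortedness, which is easy to track when a last vertex is appended or
    removed. For the converse, a strictly increasing list is determined by its members, so it equals
    [iota 1 n] filtered by membership. *)
Lemma mem_paths_1n n s : (s \in paths_1n n) =
  [&& s != [::], head 0 s == 1, last 0 s == n & sorted ltn s].
Proof.
rewrite /paths_1n mem_filter; apply/idP/idP.
  move=> /andP[/and3P[-> -> ->]] /mapP[b _ ->] /=.
  by apply: (subseq_sorted ltn_trans (mask_subseq _ _)); exact: iota_ltn_sorted.
case: s => [//|x s] /=; case/and3P => /eqP-> /eqP ls srt.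
rewrite eqxx ls eqxx /=.
have sub : subseq (1 :: s) (iota 1 n).
  suff -> : 1 :: s = [seq i <- iota 1 n | i \in 1 :: s] by exact: filter_subseq.
  apply: (irr_sorted_eq ltn_trans ltnn) => //.
    by apply: sorted_filter; [exact: ltn_trans|exact: iota_ltn_sorted].
  move=> y; rewrite mem_filter mem_iota; case: (boolP (y \in 1 :: s)) => //= ys.
  have := path_ltn_leq_last _ _ y srt ys; rewrite ls => yn; symmetry.
  apply/andP; split; last by rewrite add1n ltnS.
  move: ys; rewrite inE => /orP[/eqP->//|ys].
  by have /allP/(_ _ ys)/ltnW := order_path_min ltn_trans srt.
have /subseqP[b sb ->] := sub.
have sb' : size b == n by rewrite sb size_iota.
by apply/mapP; exists (Tuple sb'); rewrite ?mem_enum.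
Qed.

Lemma path_weight_rcons w t x s y : path_weight w (rcons (x :: s) y) t =
  path_weight w (x :: s) t + w (Posz (last x s)) (Posz y) t.
Proof.
elim: s x => [x|z s IH x].
  by rewrite /path_weight /= big_seq1 big_nil.
have /= := IH z; rewrite /path_weight /= !big_cons => ->.
by rewrite addnA.
Qed.

Lemma path_weight_le_Xmax w t n s :
  s \in paths_1n n -> path_weight w s t <= Xmax w n t.
Proof. by move=> sn; rewrite /Xmax; apply: leq_bigmax_seq. Qed.

(** A path to [j] can be extended by the edge to [n.+1]. With [Xmax_step_le], which removes the last
    edge, this gives the recursion X_{n+1} = max_j (X_j + w(j, n+1)). *)
Lemma Xmax_step_ge w t j n : 0 < j <= n ->
  Xmax w j t + w (Posz j) (Posz n.+1) t <= Xmax w n.+1 t.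
Proof.
move=> /andP[j0 jn].
have ext s : s \in paths_1n j ->
    path_weight w s t + w (Posz j) (Posz n.+1) t <= Xmax w n.+1 t.
  rewrite mem_paths_1n; case: s => [//|x s] /= /and3P[/eqP-> /eqP ls srt].
  rewrite -{1}ls -path_weight_rcons path_weight_le_Xmax// mem_paths_1n /=.
  by rewrite last_rcons rcons_path srt ls eqxx /= ltnS.
(* Some path to [j] exists, so the last edge alone weighs at most X_{n+1}; this keeps the truncated
   subtraction below faithful. *)
have [s0 s0j] : exists s, s \in paths_1n j.
  have [->|j1] := eqVneq j 1; first by exists [:: 1]; rewrite mem_paths_1n.
  by exists [:: 1; j]; rewrite mem_paths_1n /= eqxx; lia.
have s0X := ext _ s0j.
have bX : (w (Posz j) (Posz n.+1) t : nat) <= Xmax w n.+1 t.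
  exact: leq_trans (leq_addl _ _) s0X.
suff : Xmax w j t <= Xmax w n.+1 t - w (Posz j) (Posz n.+1) t by lia.
by apply/bigmax_leqP_seq => s sj _; have := ext _ sj; lia.
Qed.

Lemma Xmax_step_le w t n K : 0 < n ->
  (forall j, 0 < j <= n -> Xmax w j t + w (Posz j) (Posz n.+1) t <= K) ->
  Xmax w n.+1 t <= K.
Proof.
move=> n0 leK; apply/bigmax_leqP_seq => s + _; rewrite mem_paths_1n.
case: s => [//|x s] /= /and3P[/eqP-> /eqP ls srt].
case/lastP: s ls srt => [/= n1|s y]; first by move: n0; rewrite -[n]/(n.+1.-1) -n1.
rewrite last_rcons rcons_path => -> /andP[srt sn].
rewrite -rcons_cons path_weight_rcons.
have l0 : 0 < last 1 s by apply: (path_ltn_leq_last 1 s 1) => //; rewrite inE eqxx.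
apply: leq_trans (leK (last 1 s) _); last by rewrite l0.
by rewrite leq_add2r path_weight_le_Xmax// mem_paths_1n /= srt eqxx.
Qed.

Lemma Xmax1 w t : Xmax w 1 t = 0.
Proof.
apply/eqP; rewrite -leqn0; apply/bigmax_leqP_seq => s + _; rewrite mem_paths_1n.
case: s => [//|x [|y s]] /= /and3P[/eqP-> /eqP ls]; first by rewrite /path_weight big_nil.
move=> /andP[y1 ys]; have := path_ltn_leq_last y s y ys (mem_head _ _).
by rewrite ls; lia.
Qed.

(* The state [(x, k)] reached at vertex [m.+1]: [x] is the maximal weight of a
   path to [m.+1], and [k.+1] is the number of vertices attaining it. *)
Definition step (z : nat * nat) (v : seq bool) : nat * nat :=
  if has id (take z.2.+1 v) then (z.1.+1, 0) else (z.1, z.2.+1).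

(* Listed from the nearest vertex downwards, so that the vertices of the top
   level come first. *)
Definition row_edges (m : nat) : seq (int * int) :=
  [seq (Posz j, Posz m.+2) | j <- rev (iota 1 m.+1)].

(** The edges inside {1..m+1}, ordered by right endpoint: the state at [m.+1] is read from a prefix,
    and the next row consists of fresh, independent weights. *)
Fixpoint edges (m : nat) : seq (int * int) :=
  if m is m'.+1 then edges m' ++ row_edges m' else [::].

Fixpoint run (m : nat) (u : seq bool) : nat * nat :=
  if m is m'.+1 then
    step (run m' (take (size (edges m')) u)) (drop (size (edges m')) u)
  else (0, 0).

Definition bits w (s : seq (int * int)) t : seq bool :=
  [seq w e.1 e.2 t | e <- s].

Lemma size_row_edges m : size (row_edges m) = m.+1.
Proof. by rewrite size_map size_rev size_iota. Qed.

Lemma run_edgesS w t m : run m.+1 (bits w (edges m.+1) t) =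
  step (run m (bits w (edges m) t)) (bits w (row_edges m) t).
Proof.
by rewrite /= /bits map_cat take_size_cat ?drop_size_cat ?size_map.
Qed.

Lemma run_level_le m u : (run m u).2 <= m.
Proof.
by elim: m u => //= m IH u; rewrite /step; case: ifP => //= _; rewrite ltnS IH.
Qed.

Lemma run_weight_le m u : (run m u).1 <= m.
Proof.
elim: m u => //= m IH u; rewrite /step.
by have := IH (take (size (edges m)) u); case: ifP => //= _; lia.
Qed.

(** Since the row starts at the nearest vertex, its first [k.+1] entries are the edges leaving the
    top level of [k.+1] vertices. *)
Lemma has_take_row w t m k : k <= m ->
  reflect (exists2 j, m - k < j <= m.+1 & w (Posz j) (Posz m.+2) t)
          (has id (take k.+1 (bits w (row_edges m) t))).
Proof.
move=> km; rewrite /bits /row_edges -!map_take take_rev drop_iota size_iota.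
rewrite has_map has_map; apply: (iffP hasP) => [[j]|[j jmk wj]].
  by rewrite mem_rev mem_iota => jmk /= wj; exists j => //; lia.
by exists j => //; rewrite mem_rev mem_iota; lia.
Qed.

Lemma Xmax_run w t m : Xmax w m.+1 t = (run m (bits w (edges m) t)).1.
Proof.
(* Strengthened invariant for the induction: below the top level the maxima are strictly smaller, so
   an edge of weight 1 from there cannot raise the maximum. *)
suff : let z := run m (bits w (edges m) t) in
  (forall j, m - z.2 < j <= m.+1 -> Xmax w j t = z.1) /\
  (forall j, 0 < j <= m - z.2 -> Xmax w j t < z.1).
  by case=> + _; apply; rewrite leqnn andbT; lia.
elim: m => [/=|m].
  by split=> j jm; [have -> : j = 1 by lia|lia]; exact: Xmax1.
rewrite run_edgesS; have := run_level_le m (bits w (edges m) t).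
case: (run m (bits w (edges m) t)) => x k /= km [top low].
have leX j : 0 < j <= m.+1 -> Xmax w j t <= x.
  by move=> jm; case: (leqP j (m - k)) => jk; [apply/ltnW/low|rewrite top//]; lia.
rewrite /step; case: has_take_row => //= [[j jmk wj]|nw].
  have X2 : Xmax w m.+2 t = x.+1.
    apply/eqP; rewrite eqn_leq; apply/andP; split.
      by apply: Xmax_step_le => // i im; have := leX _ im; case: (w _ _ _); lia.
    have : 0 < j <= m.+1 by lia.
    by move=> /(Xmax_step_ge w t); rewrite top// wj addn1.
  split=> i im; first by have -> : i = m.+2 by lia.
  by rewrite ltnS leX//; lia.
have X2 : Xmax w m.+2 t = x.
  apply/eqP; rewrite eqn_leq; apply/andP; split.
    apply: Xmax_step_le => // i im; case: (leqP i (m - k)) => ik.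
      have : Xmax w i t < x by apply: low; lia.
      by case: (w _ _ _); lia.
    rewrite top; last by lia.
    case: (boolP (w i m.+2 t)) => wi; last by rewrite addn0.
    by case: nw; exists i => //; lia.
  have /(Xmax_step_ge w t) : 0 < m.+1 <= m.+1 by rewrite leqnn.
  by apply: leq_trans; rewrite top ?leq_addr//; lia.
split=> i im; last by apply: low; lia.
by case: (eqVneq i m.+2) => [->//|ne]; apply: top; lia.
Qed.

End longest_path.

(** * Expectations over finitely many Bernoulli bits *)

Section bernoulli_expectation.
Context {R : realType}.
Context (p : R).
Implicit Types f g : seq bool -> R.

(** Expectation of [f] over [n] independent Bernoulli(p) bits, as a finite recursion free of measure
    theory. *)
Fixpoint bexp (n : nat) f : R :=
  if n is n'.+1 then
    p * bexp n' (fun u => f (true :: u)) + (1 - p) * bexp n' (fun u => f (false :: u))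
  else f [::].

Lemma eq_bexp n f g : (forall u, size u = n -> f u = g u) -> bexp n f = bexp n g.
Proof.
elim: n f g => [f g fg|n IH f g fg] /=; first exact: fg.
by congr (_ * _ + _ * _); apply: IH => u un; apply: fg; rewrite /= un.
Qed.

Lemma bexp_cat m n f :
  bexp (m + n) f = bexp m (fun u => bexp n (fun v => f (u ++ v))).
Proof. by elim: m f => //= m IH f; rewrite !IH. Qed.

Lemma bexp_cst n (c : R) : bexp n (fun=> c) = c.
Proof. by elim: n => //= n ->; ring. Qed.

Lemma bexpD n f g : bexp n (fun u => f u + g u) = bexp n f + bexp n g.
Proof. by elim: n f g => //= n IH f g; rewrite !IH; ring. Qed.

Lemma bexpZ n (c : R) f : bexp n (fun u => c * f u) = c * bexp n f.
Proof. by elim: n f => //= n IH f; rewrite !IH; ring. Qed.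

Lemma le_bexp n f g : 0 <= p <= 1 -> (forall u, f u <= g u) -> bexp n f <= bexp n g.
Proof.
move=> p01; elim: n f g => //= n IH f g fg.
by apply: lerD; apply: ler_wpM2l; try apply: IH => // u; lra.
Qed.

(** The first [k] bits are all false with probability (1-p)^k. *)
Lemma bexp_has_take n k (a b : R) : (k <= n)%N ->
  bexp n (fun v => if has id (take k v) then a else b) =
  (1 - (1 - p) ^+ k) * a + (1 - p) ^+ k * b.
Proof.
elim: n k => [|n IH] [|k] //= kn; rewrite ?expr0 ?bexp_cst; try ring.
by rewrite IH// exprS; ring.
Qed.

Definition state_exp (m : nat) (F : nat * nat -> R) : R :=
  bexp (size (edges m)) (fun u => F (run m u)).

(** Transition rule of the Markov chain: the last row is averaged out with the previous state held
    fixed. [run_level_le] ensures that the row is long enough to contain the whole top level. *)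
Lemma state_expS m F : state_exp m.+1 F =
  state_exp m (fun z => (1 - (1 - p) ^+ z.2.+1) * F (z.1.+1, 0%N)
                        + (1 - p) ^+ z.2.+1 * F (z.1, z.2.+1)).
Proof.
rewrite /state_exp [edges m.+1]/= size_cat bexp_cat; apply: eq_bexp => u um.
rewrite -(@bexp_has_take (size (row_edges m))); last first.
  by rewrite size_row_edges ltnS run_level_le.
apply: eq_bexp => v _.
by rewrite /= take_size_cat// drop_size_cat// /step; case: ifP.
Qed.

End bernoulli_expectation.

(** * From independent edge weights to finite expectations *)

Section cylinders.
Context {d : measure_display} {T : measurableType d} {R : realType}.
Context (P : probability T R) (p : R) (w : int -> int -> T -> bool).
Context (bw : bernoulli_edge_weights P p w).

Definition cylinder (s : seq (int * int)) (b : int * int -> bool) : set T :=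
  \bigcap_(e in [set` s]) [set t | w e.1 e.2 t = b e].

Lemma measurable_weight i j : measurable_fun setT (w i j).
Proof. by apply: (measurable_fun_bool true); rewrite setTI; exact: bw.1. Qed.

Lemma measurable_cylinder s b : measurable (cylinder s b).
Proof.
apply: fin_bigcap_measurable => [|e _]; first exact: finite_seq.
rewrite -[X in measurable X]setTI.
exact: (measurable_weight e.1 e.2 measurableT [set b e]).
Qed.

Lemma measurable_bits_fun s (f : seq bool -> R) :
  measurable_fun setT (fun t => f (bits w s t)).
Proof.
elim: s f => [f|e s IH f]; first exact: (measurable_cst (f [::])).
rewrite (_ : (fun t => _) = fun t => if w e.1 e.2 t
   then f (true :: bits w s t) else f (false :: bits w s t)); last first.
  by apply/funext => t /=; case: (w e.1 e.2 t).
apply: measurable_fun_ifT; first exact: measurable_weight.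
- exact: (IH (fun u => f (true :: u))).
- exact: (IH (fun u => f (false :: u))).
Qed.

Lemma cylinder_cons e s b : cylinder (e :: s) b =
  [set t | w e.1 e.2 t = b e] `&` cylinder s b.
Proof.
apply/seteqP; split => t.
  move=> H; split; first by apply: H; rewrite /= mem_head.
  by move=> i /= si; apply: H; rewrite /= inE si orbT.
move=> [H1 H2] i /=; rewrite inE => /orP[/eqP->//|]; exact: H2.
Qed.

Lemma eq_cylinder s b c : {in s, b =1 c} -> cylinder s b = cylinder s c.
Proof.
move=> bc; apply/seteqP; split => t H i /= si; have := H i si => /= ->; rewrite bc//.
Qed.

(** [s0] collects the edges whose values are already fixed. The induction moves one edge from [s] to
    [s0], splitting the cylinder by its value; once [s] is empty, the independence hypothesis gives
    the product. *)
Lemma integral_bits_cylinder s s0 b (f : seq bool -> R) :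
  uniq (s ++ s0) -> all (fun e => e.1 < e.2) (s ++ s0) -> (forall u, 0 <= f u) ->
  (\int[P]_(t in cylinder s0 b) (f (bits w s t))%:E)%E =
  (bexp p (size s) f * \prod_(e <- s0) (if b e then p else 1 - p))%:E.
Proof.
elim: s s0 b f => [|e s IH] s0 b f /= us ls f0.
  rewrite integral_cst; last exact: measurable_cylinder.
  by rewrite EFinM -(bw.2 s0 b us ls).
move: us ls => /andP[]; rewrite mem_cat negb_or => /andP[es es0] us /andP[le ls].
(* The pattern [b] with the value [c] imposed at [e]; as [e] is not in [s0], nothing changes
   there. *)
pose be c := fun e' => if e' == e then c else b e'.
have beE c : cylinder (e :: s0) (be c) = [set t | w e.1 e.2 t = c] `&` cylinder s0 b.
  rewrite cylinder_cons /be eqxx; congr (_ `&` _); apply: eq_cylinder => i is0.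
  by case: eqP => // ie; move: es0; rewrite -ie is0.
have prodE c : \prod_(e' <- e :: s0) (if be c e' then p else 1 - p) =
    (if c then p else 1 - p) * \prod_(e' <- s0) (if b e' then p else 1 - p).
  rewrite big_cons /be eqxx; congr (_ * _); apply: eq_big_seq => i is0.
  by case: eqP => // ie; move: es0; rewrite -ie is0.
have H c : (\int[P]_(t in cylinder (e :: s0) (be c)) (f (bits w (e :: s) t))%:E)%E =
   (bexp p (size s) (fun u => f (c :: u)) * ((if c then p else 1 - p) *
     \prod_(e' <- s0) (if b e' then p else 1 - p)))%:E.
  rewrite -prodE -IH; last by move=> u.
  - by apply: eq_integral => t; rewrite inE beE => -[/= -> _].
  - by rewrite -cat_rcons -cats1 -catA /= -cat1s uniq_catCA /= mem_cat negb_or es es0.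
  - by move: ls; rewrite !all_cat /= le => /andP[-> ->].
have -> : cylinder s0 b = cylinder (e :: s0) (be true) `|` cylinder (e :: s0) (be false).
  rewrite !beE -setIUl; apply/seteqP; split => [t Ct|t []//]; split => //=.
  by case: (w e.1 e.2 t); [left|right].
rewrite ge0_integral_setU.
- by rewrite !H -EFinD; congr (_%:E); ring.
- exact: measurable_cylinder.
- exact: measurable_cylinder.
- by apply/measurable_EFinP/measurable_funTS; exact: (measurable_bits_fun (e :: s) f).
- by move=> t _; rewrite lee_fin.
- rewrite !beE; apply/disj_setPS => t [[/= -> _] [/= ]].
  by [].
Qed.

Lemma integral_bits s (f : seq bool -> R) :
  uniq s -> all (fun e => e.1 < e.2) s -> (forall u, 0 <= f u) ->
  (\int[P]_t (f (bits w s t))%:E)%E = (bexp p (size s) f)%:E.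
Proof.
move=> us ls f0; have := integral_bits_cylinder s [::] xpredT f.
rewrite cats0 big_nil mulr1 => <- //; congr (integral _ _ _).
by apply/seteqP; split => // t _ i /=; rewrite in_nil.
Qed.

Lemma mem_row_edges m e : e \in row_edges m -> [/\ e.1 < e.2 & e.2 = Posz m.+2].
Proof.
move=> /mapP[j]; rewrite mem_rev mem_iota => jm -> /=; split => //.
by rewrite ltz_nat; lia.
Qed.

Lemma edges_lt m : all (fun e => e.1 < e.2) (edges m).
Proof.
elim: m => //= m IH; rewrite all_cat IH /=; apply/allP => e.
by case/mem_row_edges.
Qed.

Lemma mem_edges m e : e \in edges m -> e.2 <= Posz m.+1.
Proof.
elim: m => //= m IH; rewrite mem_cat => /orP[/IH|/mem_row_edges[_ ->//]].
by move=> /le_trans; apply; rewrite lez_nat.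
Qed.

Lemma edges_uniq m : uniq (edges m).
Proof.
elim: m => //= m IH; rewrite cat_uniq IH /= map_inj_uniq ?rev_uniq ?iota_uniq ?andbT.
  apply/hasPn => e /mem_row_edges[_ e2]; apply/negP => /mem_edges.
  by rewrite e2 lez_nat ltnn.
by move=> i j [].
Qed.

Lemma integral_state m (F : nat * nat -> R) : (forall z, 0 <= F z) ->
  (\int[P]_t (F (run m (bits w (edges m) t)))%:E)%E = (state_exp p m F)%:E.
Proof.
move=> F0; exact: (integral_bits _ (fun u => F (run m u)) (edges_uniq m) (edges_lt m)).
Qed.

End cylinders.

(** * The level series and the Poisson equation *)

Section corrector.
Context {R : realType}.
Context (p : R).
Context (p01 : 0 < p < 1).

Let q_ge0 : 0 <= 1 - p. Proof. by case/andP: p01; lra. Qed.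
Let q_le1 : 1 - p <= 1. Proof. by case/andP: p01; lra. Qed.

Definition level_term (k i : nat) : R := (1 - p) ^+ (k.+1 * i + 'C(i, 2)).

(* The [S_(k+1)] of the header: as in [step], a level of [k.+1] vertices has index [k]. *)
Definition level_series (k : nat) : R := limn (series (level_term k)).

Lemma level_term_ge0 k i : 0 <= level_term k i.
Proof. exact: exprn_ge0. Qed.

Lemma is_cvg_level_series k : cvgn (series (level_term k)).
Proof.
apply: (@series_le_cvg _ _ (geometric 1 (1 - p))) => [i|i|i|].
- exact: level_term_ge0.
- by rewrite /= mul1r exprn_ge0.
- rewrite /= mul1r; apply: ler_wiXn2l => //.
  by rewrite mulSn -addnA leq_addr.
- by apply: is_cvg_geometric_series; rewrite ger0_norm//; case/andP: p01; lra.
Qed.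

(** By C(i+1,2) = C(i,2) + i, term i+1 of the series at [k] is (1-p)^(k+1) times term i of the
    series at [k.+1]. *)
Lemma level_seriesS k : level_series k = 1 + (1 - p) ^+ k.+1 * level_series k.+1.
Proof.
apply/cvg_lim => //; rewrite -cvg_shiftS /=.
rewrite (_ : (fun n => _) = fun n => 1 + (1 - p) ^+ k.+1 * series (level_term k.+1) n).
  apply: cvgD; first exact: cvg_cst.
  by apply: cvgMl_tmp; exact: is_cvg_level_series.
apply/funext => n; rewrite /series /= big_nat_recl//; congr (_ + _).
  by rewrite /level_term muln0.
rewrite big_distrr /=; apply: eq_bigr => i _.
by rewrite /level_term -exprD binS bin1; congr (_ ^+ _); lia.
Qed.

Lemma level_series_ge1 k : 1 <= level_series k.
Proof.
have -> : 1 = series (level_term k) 1 by rewrite /series /= big_nat1 /level_term muln0.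
apply: nondecreasing_cvgn_le; last exact: is_cvg_level_series.
by apply: nondecreasing_series => i _ _; exact: level_term_ge0.
Qed.

Lemma level_series_le k : level_series k <= level_series 0.
Proof.
apply: ler_lim; [exact: is_cvg_level_series|exact: is_cvg_level_series|].
apply: nearW => n; rewrite /series /=; apply: ler_sum => i _.
by apply: ler_wiXn2l => //; rewrite leq_add2r leq_mul.
Qed.

Lemma beta_trE : beta_tr p = (level_series 0)^-1.
Proof.
rewrite /beta_tr; congr (_^-1); apply/cvg_lim => //; rewrite -cvg_shiftS /=.
rewrite (_ : (fun n => _) = series (level_term 0)); first exact: is_cvg_level_series.
apply/funext => n; rewrite big_add1 /series /=; apply: eq_bigr => i _.
by rewrite /level_term binS bin1 mul1n addnC.
Qed.

Notation beta := (beta_tr p).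

Lemma beta_tr_gt0 : 0 < beta.
Proof. by rewrite beta_trE invr_gt0 (lt_le_trans _ (level_series_ge1 _)). Qed.

Lemma beta_tr_le1 : beta <= 1.
Proof.
by rewrite beta_trE invf_le1 ?level_series_ge1// (lt_le_trans _ (level_series_ge1 _)).
Qed.

(* Solution of the Poisson equation of the level-size chain: it turns
   [x - beta m] into a martingale with bounded increments. *)
Definition corrector (k : nat) : R := 1 - beta * level_series k.

Lemma corrector0 : corrector 0 = 0.
Proof.
rewrite /corrector beta_trE mulVf ?subrr// gt_eqF//.
exact: lt_le_trans (level_series_ge1 _).
Qed.

Lemma corrector_ge0 k : 0 <= corrector k.
Proof.
rewrite -corrector0 /corrector lerD2l lerN2 ler_pM2l ?beta_tr_gt0//.
exact: level_series_le.
Qed.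

Lemma corrector_le1 k : corrector k <= 1.
Proof.
rewrite /corrector gerBl mulr_ge0//; first exact/ltW/beta_tr_gt0.
exact: le_trans (level_series_ge1 _).
Qed.

(** The Poisson equation: 1 - (1-p)^(k+1) is the probability that the weight increases, and the
    reset to level index 0 contributes nothing because [corrector 0] vanishes. *)
Lemma correctorE k : corrector k =
  1 - (1 - p) ^+ k.+1 + (1 - p) ^+ k.+1 * corrector k.+1 - beta.
Proof. by rewrite /corrector level_seriesS; ring. Qed.

(** * Second and fourth moments of the martingale *)

Lemma centered_sqr_le (a x y z : R) : 0 <= a <= 1 -> `|x| <= 2 -> `|y| <= 2 ->
  (1 - a) * x + a * y = 0 ->
  (1 - a) * (z + x) ^+ 2 + a * (z + y) ^+ 2 <= z ^+ 2 + 4.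
Proof.
move=> /andP[a0 a1]; rewrite !ler_norml => /andP[x1 x2] /andP[y1 y2] xy.
have -> : (1 - a) * (z + x) ^+ 2 + a * (z + y) ^+ 2 =
  z ^+ 2 + 2 * z * ((1 - a) * x + a * y) + ((1 - a) * x ^+ 2 + a * y ^+ 2) by ring.
have x4 : x ^+ 2 <= 4 by nra.
have y4 : y ^+ 2 <= 4 by nra.
by rewrite xy; nra.
Qed.

(** The pointwise bound [one] keeps the term linear in the increment, which averages to zero; 40 and
    32 come from 10 z^2 u^2 + 2 u^4 with u^2 <= 4. *)
Lemma centered_exp4_le (a x y z : R) : 0 <= a <= 1 -> `|x| <= 2 -> `|y| <= 2 ->
  (1 - a) * x + a * y = 0 ->
  (1 - a) * (z + x) ^+ 4 + a * (z + y) ^+ 4 <= z ^+ 4 + 40 * z ^+ 2 + 32.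
Proof.
move=> /andP[a0 a1]; rewrite !ler_norml => /andP[x1 x2] /andP[y1 y2] xy.
have one u : - 2 <= u -> u <= 2 ->
    (z + u) ^+ 4 <= z ^+ 4 + 4 * z ^+ 3 * u + 40 * z ^+ 2 + 32.
  move=> u1 u2.
  have u4 : u ^+ 2 <= 4 by nra.
  have uu : 0 <= u ^+ 2 by exact: sqr_ge0.
  have zz : 0 <= z ^+ 2 by exact: sqr_ge0.
  (* AM-GM: [4 z u^3 <= 4 z^2 u^2 + u^4] *)
  have -> : (z + u) ^+ 4 = z ^+ 4 + 4 * z ^+ 3 * u + 10 * (z ^+ 2 * u ^+ 2)
     + 2 * (u ^+ 2) ^+ 2 - (u * (2 * z - u)) ^+ 2 by ring.
  have := sqr_ge0 (u * (2 * z - u)).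
  have : (u ^+ 2) ^+ 2 <= 16 by nra.
  have : z ^+ 2 * u ^+ 2 <= z ^+ 2 * 4 by exact: ler_wpM2l.
  by lra.
have /(ler_wpM2l a0) := one y y1 y2.
have a1' : 0 <= 1 - a by lra.
have /(ler_wpM2l a1') := one x x1 x2.
have : 4 * z ^+ 3 * ((1 - a) * x + a * y) = 0 by rewrite xy mulr0.
by lra.
Qed.

Definition deviation (m : nat) (z : nat * nat) : R := z.1%:R - beta * m%:R.

Definition mart (m : nat) (z : nat * nat) : R := deviation m z + corrector z.2.

Let mart_up m z : mart m.+1 (z.1.+1, 0%N) = mart m z + (1 - beta - corrector z.2).
Proof. by rewrite /mart /deviation /= corrector0 -!natr1; ring. Qed.

Let mart_stay m z : mart m.+1 (z.1, z.2.+1) =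
  mart m z + (corrector z.2.+1 - corrector z.2 - beta).
Proof. by rewrite /mart /deviation /= -!natr1; ring. Qed.

Let expq01 k : 0 <= (1 - p) ^+ k <= 1.
Proof. by rewrite exprn_ge0//= exprn_ile1. Qed.

Let up_le k : `|1 - beta - corrector k| <= 2.
Proof.
have := beta_tr_gt0; have := beta_tr_le1.
have := corrector_ge0 k; have := corrector_le1 k.
by rewrite ler_norml; lra.
Qed.

Let stay_le k : `|corrector k.+1 - corrector k - beta| <= 2.
Proof.
have := beta_tr_gt0; have := beta_tr_le1.
have := corrector_ge0 k; have := corrector_le1 k.
have := corrector_ge0 k.+1; have := corrector_le1 k.+1.
by rewrite ler_norml; lra.
Qed.

(** The martingale property: given the level, the increment of [mart] has mean zero. *)
Let drift0 k : (1 - (1 - p) ^+ k.+1) * (1 - beta - corrector k) +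
  (1 - p) ^+ k.+1 * (corrector k.+1 - corrector k - beta) = 0.
Proof. by rewrite [corrector k]correctorE; ring. Qed.

Let p01' : 0 <= p <= 1. Proof. by case/andP: p01 => /ltW-> /ltW->. Qed.

Lemma state_exp_mart2 m : state_exp p m (fun z => mart m z ^+ 2) <= 4 * m%:R.
Proof.
elim: m => [|m IH].
  by rewrite /state_exp /= /mart /deviation /= corrector0; lra.
rewrite state_expS.
apply: (@le_trans _ _ (state_exp p m (fun z => mart m z ^+ 2 + 4))); last first.
  by rewrite /state_exp bexpD bexp_cst -natr1; move: IH; rewrite /state_exp; lra.
apply: le_bexp => // u; rewrite mart_up mart_stay.
by apply: centered_sqr_le.
Qed.

(** One step adds at most 40 * 4m + 32 by the second moment bound, which is below 80 ((m+1)^2 - m^2)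
    = 160 m + 80. *)
Lemma state_exp_mart4 m : state_exp p m (fun z => mart m z ^+ 4) <= 80 * m%:R ^+ 2.
Proof.
elim: m => [|m IH].
  by rewrite /state_exp /= /mart /deviation /= corrector0; lra.
rewrite state_expS.
apply: (@le_trans _ _ (state_exp p m
  (fun z => mart m z ^+ 4 + (40 * mart m z ^+ 2 + 32)))); last first.
  have := state_exp_mart2 m; rewrite /state_exp !bexpD bexpZ bexp_cst -natr1.
  move: IH; rewrite /state_exp.
  by have : 0 <= m%:R :> R by []; lra.
apply: le_bexp => // u; rewrite mart_up mart_stay [leRHS]addrA.
by apply: centered_exp4_le.
Qed.

(** The corrector lies in [0,1], so removing it costs a factor 8 and a constant 8; for m >= 1 this
    gives 8 * 80 + 8 = 648. *)
Lemma state_exp_deviation4 m : (0 < m)%N ->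
  state_exp p m (fun z => deviation m z ^+ 4) <= 648 * m%:R ^+ 2.
Proof.
move=> m0; apply: (@le_trans _ _ (state_exp p m (fun z => 8 * mart m z ^+ 4 + 8))).
  apply: le_bexp => // u; rewrite /mart.
  move: (run m u) => z; move: (deviation m z) => D.
  have := corrector_ge0 z.2; have := corrector_le1 z.2.
  move: (corrector z.2) => c c1 c0.
  have D2 : D ^+ 2 <= 2 * (D + c) ^+ 2 + 2 by have := sqr_ge0 (D + 2 * c); nra.
  have -> : D ^+ 4 = (D ^+ 2) ^+ 2 by ring.
  have -> : (D + c) ^+ 4 = ((D + c) ^+ 2) ^+ 2 by ring.
  have D0 := sqr_ge0 D; have M0 := sqr_ge0 (D + c).
  move: (D ^+ 2) ((D + c) ^+ 2) D2 D0 M0 => A B AB A0 B0.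
  have : A ^+ 2 <= (2 * B + 2) ^+ 2 by rewrite ler_sqr// nnegrE; lra.
  by have := sqr_ge0 (B - 1); nra.
rewrite /state_exp bexpD bexp_cst bexpZ; have := state_exp_mart4 m; rewrite /state_exp.
have : 1 <= m%:R ^+ 2 :> R by rewrite exprn_ege1// ler1n.
by lra.
Qed.
End corrector.

(** * Almost sure convergence from summable integrals *)

(** The sum of the [f n] has finite integral, hence is finite almost everywhere, and the terms of a
    convergent series tend to 0. *)
Lemma ae_cvg0_summable {d : measure_display} {T : measurableType d} {R : realType}
    (mu : {measure set T -> \bar R}) (f : nat -> T -> R) :
  (forall n, measurable_fun setT (f n)) -> (forall n t, 0 <= f n t) ->
  (\sum_(0 <= n <oo) \int[mu]_t (f n t)%:E < +oo)%E ->
  {ae mu, forall t, f ^~ t @ \oo --> (0 : R)}.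
Proof.
move=> mf f0 sumf.
pose F t := (\sum_(0 <= n <oo) (f n t)%:E)%E.
have F0 t : (0 <= F t)%E by apply: nneseries_ge0 => n _ _; rewrite lee_fin.
have mEf n : measurable_fun setT (EFin \o f n) by exact/measurable_EFinP.
have iF : mu.-integrable setT F.
  apply/integrableP; split.
    apply: (ge0_emeasurable_sum (h := fun n => EFin \o f n) (P := xpredT)) => //.
    by move=> n t _ _; rewrite lee_fin.
  under eq_integral do rewrite gee0_abs//.
  by rewrite integral_nneseries// => n t _; rewrite lee_fin.
have := integrable_ae measurableT iF.
apply: filterS => t /(_ I) Ffin.
apply: cvg_series_cvg_0; apply: nondecreasing_is_cvgn.
  by apply: nondecreasing_series.
exists (fine (F t)) => _ [n _ <-].
rewrite -lee_fin fineK// /series /= -sumEFin.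
by apply: nneseries_lim_ge => i _ _; rewrite lee_fin.
Qed.

Lemma sum_inv_sqr_le {R : realType} n :
  \sum_(0 <= i < n) (i.+1%:R ^+ 2)^-1 <= 2 :> R.
Proof.
(* Telescoping: 1/(i+1)^2 <= 2/((i+1)(i+2)) = 2/(i+1) - 2/(i+2). *)
suff : \sum_(0 <= i < n) (i.+1%:R ^+ 2)^-1 <= 2 - 2 / n.+1%:R :> R.
  by move=> /le_trans; apply; rewrite gerBl divr_ge0.
elim: n => [|n IH]; first by rewrite big_nil divr1 subrr.
rewrite big_nat_recr//=; apply: (le_trans (lerD IH (lexx _))).
rewrite -subr_ge0 -[n.+2%:R]natr1 -[n.+1%:R]natr1; set x : R := n%:R.
have x0 : 0 <= x by [].
have -> : 2 - 2 / (x + 1 + 1) - (2 - 2 / (x + 1) + ((x + 1) ^+ 2)^-1) =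
  x / ((x + 1) ^+ 2 * (x + 1 + 1)) by field; apply/andP; split; apply/eqP; lra.
by rewrite divr_ge0// mulr_ge0 ?sqr_ge0//; lra.
Qed.

(** * The strong law for the longest path *)

Section strong_law.
Context {d : measure_display} {T : measurableType d} {R : realType}.
Context (P : probability T R) (p : R) (w : int -> int -> T -> bool).
Context (p01 : 0 < p < 1).
Context (bw : bernoulli_edge_weights P p w).

(** No path from 1 ends at 0, and the empty maximum is 0. *)
Lemma Xmax0 t : Xmax w 0 t = 0%N.
Proof.
apply/eqP; rewrite -leqn0; apply/bigmax_leqP_seq => s + _; rewrite mem_paths_1n.
case: s => [//|x s] /= /and3P[/eqP-> /eqP ls srt].
by have := path_ltn_leq_last 1 s 1 srt (mem_head _ _); rewrite ls.
Qed.

Lemma Xmax_le n t : (Xmax w n t <= n.-1)%N.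
Proof. by case: n => [|m]; rewrite ?Xmax0// Xmax_run run_weight_le. Qed.

Lemma measurable_Xmax n : measurable_fun setT (fun t => (Xmax w n t)%:R : R).
Proof.
case: n => [|m]; first by under eq_fun do rewrite Xmax0; exact: measurable_cst.
under eq_fun do rewrite Xmax_run.
exact: (measurable_bits_fun _ _ _ bw (edges m) (fun u => (run m u).1%:R)).
Qed.

(** Provides the dominating constant for the convergence of integrals. For [n] equal to 0 or 1 the
    numerator is 0, so the quotient is 0 even where the denominator vanishes. *)
Lemma Xmax_ratio_le1 n t : `|(Xmax w n t)%:R / (n%:R - 1)| <= 1 :> R.
Proof.
case: n => [|[|m]]; rewrite ?Xmax0 ?Xmax1 ?mul0r ?normr0//.
rewrite -[m.+2%:R]natr1 addrK ger0_norm ?divr_ge0//.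
by rewrite ler_pdivrMr// mul1r ler_nat Xmax_le.
Qed.

(** Indexed by n = m + 2, so that the denominator n - 1 = m + 1 is positive. *)
Let ratio_dev4 m t := ((Xmax w m.+2 t)%:R / m.+1%:R - beta_tr p) ^+ 4.

Lemma ratio_dev4E m t : ratio_dev4 m t =
  (m.+1%:R ^+ 4)^-1 * deviation p m.+1 (run m.+1 (bits w (edges m.+1) t)) ^+ 4.
Proof.
rewrite /ratio_dev4 Xmax_run /deviation -exprVn -exprMn; congr (_ ^+ _).
by rewrite mulrBr mulrCA [_^-1 * _]mulrC mulVf ?mulr1// pnatr_eq0.
Qed.

Lemma integral_ratio_dev4_le m :
  (\int[P]_t (ratio_dev4 m t)%:E <= (648 * (m.+1%:R ^+ 2)^-1)%:E)%E.
Proof.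
under eq_integral do rewrite ratio_dev4E.
rewrite (integral_state P p w bw m.+1
  (fun z => (m.+1%:R ^+ 4)^-1 * deviation p m.+1 z ^+ 4)); last first.
  by move=> z; apply: mulr_ge0; rewrite ?invr_ge0 exprn_even_ge0.
rewrite lee_fin /state_exp bexpZ mulrC ler_pdivrMr ?exprn_gt0//.
apply: (le_trans (state_exp_deviation4 p p01 m.+1 _)) => //.
by rewrite [_ ^+ 4](exprM _ 2 2) -mulrA mulKf// expf_neq0.
Qed.

Lemma Xmax_ratio_cvg_ae :
  {ae P, forall t, (fun n : nat => (Xmax w n t)%:R / (n%:R - 1) : R)
                          @ \oo --> beta_tr p}.
Proof.
have f0 m t : 0 <= ratio_dev4 m t by rewrite exprn_even_ge0.
have mf m : measurable_fun setT (ratio_dev4 m).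
  apply: measurable_funX; apply: measurable_funB; last exact: measurable_cst.
  by apply: measurable_funM; [exact: measurable_Xmax|exact: measurable_cst].
have : (\sum_(0 <= m <oo) \int[P]_t (ratio_dev4 m t)%:E < +oo)%E.
  have int0 m : (0 <= \int[P]_t (ratio_dev4 m t)%:E)%E.
    by apply: integral_ge0 => t _; rewrite lee_fin.
  (* 1296 = 648 * 2, with 2 bounding the sum of the inverse squares. *)
  apply: (@le_lt_trans _ _ (1296 : R)%:E); last exact: ltry.
  apply: lime_le; first by apply: is_cvg_nneseries.
  apply: nearW => n.
  apply: (@le_trans _ _ (\sum_(0 <= m < n) (648 * (m.+1%:R ^+ 2)^-1)%:E)%E).
    by apply: lee_sum => m _; exact: integral_ratio_dev4_le.
  rewrite sumEFin lee_fin -big_distrr /=; have := @sum_inv_sqr_le R n; lra.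
move=> /(ae_cvg0_summable P _ mf f0); apply: filterS => t cvg4.
(* Two shifts pass from n to m + 2; closeness within [e] then amounts to a fourth power below
   [e ^+ 4]. *)
rewrite -cvg_shiftS -cvg_shiftS /=; apply/cvgrPdistC_lt => e e0.
have e4 : 0 < e ^+ 4 by exact: exprn_gt0.
move/cvgr0Pnorm_lt : cvg4 => /(_ _ e4); apply: filterS => m.
by rewrite /ratio_dev4 -[m.+2%:R]natr1 addrK normrX ltr_pXn2r// nnegrE ltW.
Qed.

End strong_law.

(** * Convergence in mean by domination *)

Theorem theorem5 (d : measure_display) (T : measurableType d) (R : realType)
  (P : probability T R) (p : R) (w : int -> int -> T -> bool) :
  0 < p < 1 ->
  bernoulli_edge_weights P p w ->
  [/\ {ae P, forall t, (fun n : nat => (Xmax w n t)%:R / (n%:R - 1) : R)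
                          @ \oo --> beta_tr p},
      (fun n : nat =>
         (\int[P]_t (`| Xplus (R := R) w n t / (n%:R - 1) - beta_tr p |)%:E)%E)
         @ \oo --> 0%E
    & (fun n : nat =>
         ('E_P[fun t => (Xmax w n t)%:R : R] * ((n%:R - 1)^-1)%:E)%E)
         @ \oo --> (beta_tr p)%:E].
Proof.
move=> p01 bw; have aeX := Xmax_ratio_cvg_ae P p w p01 bw.
pose Y n t : R := (Xmax w n t)%:R / (n%:R - 1).
have mX n := measurable_Xmax P p w bw n.
have mY n : measurable_fun setT (EFin \o Y n).
  apply/measurable_EFinP; apply: measurable_funM; first exact: mX.
  exact: measurable_cst.
have [_ cvg1 cvgE] : [/\ P.-integrable setT (EFin \o cst (beta_tr p)),
    (fun n => (\int[P]_t `|(Y n t)%:E - (beta_tr p)%:E|)%E) @ \oo --> 0%E &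
    (fun n => (\int[P]_t (Y n t)%:E)%E) @ \oo --> (\int[P]_t (beta_tr p)%:E)%E].
  apply: (@dominated_convergence _ _ _ P setT measurableT
    (fun n => EFin \o Y n) (EFin \o cst (beta_tr p)) (EFin \o cst 1)) => //.
  - by apply/measurable_EFinP; exact: measurable_cst.
  - apply: filterS aeX => t cvgt _; apply: cvg_EFin; last exact: cvgt.
    exact: nearW.
  - exact: finite_measure_integrable_cst.
  - by apply: aeW => t n _; rewrite /= lee_fin Xmax_ratio_le1.
split => //.
- apply: cvg_trans cvg1; apply: near_eq_cvg; apply: nearW => n.
  (* [Xmax] is a natural number, so its positive part is itself. *)
  by apply: eq_integral => t _; rewrite /Xplus max_l//.
- have intb : (\int[P]_t (beta_tr p)%:E = (beta_tr p)%:E)%E.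
    by have := expectation_cst P (beta_tr p); rewrite unlock.
  rewrite intb in cvgE.
  (* Pulling out the factor 1/(n-1) uses its nonnegativity, which fails at n = 0; hence only
     eventual equality is claimed. *)
  apply: cvg_trans cvgE; apply: near_eq_cvg; near=> n.
  rewrite unlock -ge0_integralZr//; last first.
  + by rewrite lee_fin invr_ge0 subr_ge0 ler1n; near: n; exact: nbhs_infty_gt.
  + exact/measurable_EFinP.
Unshelve. all: by end_near.
Qed.
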